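(* Let $G$ be a finite simple Cohen–Macaulay König graph without isolated vertices. Then (a) $G$ has a unique perfect matching $P$, and $P$ is the set of exchange edges of $G$; and (b) the graph $\mathcal{G}_{I_c(G)}$ is bipartite.
   Context: $G$ has vertices $t_1,\dots,t_s$; $G$ is Cohen–Macaulay if $S/I(G)$ is Cohen–Macaulay, $S=K[t_1,\dots,t_s]$ over a field $K$, $I(G)=(t_it_j:\{t_i,t_j\}\in E(G))$; such $G$ is unmixed (all minimal vertex covers have the same size). $\alpha_0(G)$ is the minimum size of a vertex cover; $G$ is König if it has a matching with $\alpha_0(G)$ edges. An edge $\{t,t'\}$ of $G$ is an exchange edge if there exist minimal vertex covers $C,C'$ of $G$ with $C'=(C\setminus\{t\})\cup\{t'\}$. $\mathcal{G}_{I_c(G)}$ has the minimal vertex covers of $G$ as vertices, with $\{C_i,C_j\}$ ($i\neq j$) an edge iff $|C_i\cup C_j|=|C_i|+1$.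
   Formalization: In the definition of exchange edge the minimal vertex covers C and C' are required to be distinct (so t lies in C and t' does not); if C = C' were allowed, every edge would be an exchange edge and (a) would fail, e.g. for the path on four vertices. *)

(* Defs.v *)
From HB Require Import structures.
From mathcomp Require Import all_boot all_order all_algebra.
From mathcomp Require Import mpoly.

Set Implicit Arguments.
Unset Strict Implicit.
Unset Printing Implicit Defensive.

Import GRing.Theory.
Local Open Scope ring_scope.

Section Graph.
Variable n : nat.
Variable e : rel 'I_n.

Definition simple_graph : Prop := ssrbool.symmetric e /\ irreflexive e.

Definition no_isolated : Prop := forall x : 'I_n, exists y, e x y.

Definition is_edge (E : {set 'I_n}) : bool :=
  [exists x, exists y, e x y && (E == [set x; y])].

Definition vertex_cover (C : {set 'I_n}) : bool :=
  [forall x, forall y, e x y ==> (x \in C) || (y \in C)].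

Definition min_vertex_cover (C : {set 'I_n}) : bool :=
  minset vertex_cover C.

Definition alpha0 : nat :=
  \big[minn/n]_(C : {set 'I_n} | vertex_cover C) #|C|.

Definition matching (M : {set {set 'I_n}}) : bool :=
  [forall E in M, is_edge E] &&
  [forall E in M, forall F in M, (E != F) ==> [disjoint E & F]].

Definition perfect_matching (M : {set {set 'I_n}}) : bool :=
  matching M && [forall x, exists E in M, x \in E].

Definition Konig : Prop :=
  exists M, matching M /\ #|M| = alpha0.

Definition exchange_edge (E : {set 'I_n}) : bool :=
  [exists t, exists t', [&& e t t', E == [set t; t'] &
     [exists C, exists C', [&& min_vertex_cover C, min_vertex_cover C',
        C != C' & C' == (C :\ t) :|: [set t']]]]].

Definition exchange_edges : {set {set 'I_n}} := [set E | exchange_edge E].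

Definition Ic_adj (Ci Cj : {set 'I_n}) : bool :=
  [&& min_vertex_cover Ci, min_vertex_cover Cj, Ci != Cj &
      #|Ci :|: Cj| == #|Ci|.+1].

Definition Ic_bipartite : Prop :=
  exists A : {set {set 'I_n}}, forall Ci Cj,
    Ic_adj Ci Cj -> (Ci \in A) != (Cj \in A).

End Graph.

Section CM.
Variable K : fieldType.
Variable n : nat.
Local Notation S := {mpoly K[n]}.

Definition ideal_gen (A : S -> Prop) : S -> Prop :=
  fun f => exists s : seq (S * S),
    (forall p, p \in s -> A p.2) /\ f = \sum_(p <- s) p.1 * p.2.

Definition edge_ideal (e : rel 'I_n) : S -> Prop :=
  ideal_gen (fun g => exists i j, e i j /\ g = 'X_i * 'X_j).

(* the homogeneous maximal ideal m = (t_1, ..., t_n) *)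
Definition irrelevant (f : S) : Prop := f@_0%MM = 0.

Definition is_ideal (P : S -> Prop) : Prop :=
  P 0 /\ (forall f g, P f -> P g -> P (f + g)) /\
  (forall f g, P g -> P (f * g)).

Definition prime_ideal (P : S -> Prop) : Prop :=
  is_ideal P /\ ~ P 1 /\ (forall f g, P (f * g) -> P f \/ P g).

Definition subset_strict (P Q : S -> Prop) : Prop :=
  (forall f, P f -> Q f) /\ exists f, Q f /\ ~ P f.

Definition prime_chain (I : S -> Prop) (c : seq (S -> Prop)) : Prop :=
  (0 < size c)%N /\
  (forall i, (i < size c)%N ->
     prime_ideal (nth (fun _ => False) c i) /\
     forall f, I f -> nth (fun _ => False) c i f) /\
  (forall i, (i.+1 < size c)%N ->
     subset_strict (nth (fun _ => False) c i) (nth (fun _ => False) c i.+1)).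

Definition krull_dim (I : S -> Prop) (d : nat) : Prop :=
  (exists c, prime_chain I c /\ (size c).-1 = d) /\
  (forall c, prime_chain I c -> ((size c).-1 <= d)%N).

Definition nzd_mod (J : S -> Prop) (f : S) : Prop :=
  forall g, J (f * g) -> J g.

Definition add_elts (I : S -> Prop) (fs : seq S) : S -> Prop :=
  ideal_gen (fun g => I g \/ g \in fs).

Definition regular_seq (I : S -> Prop) (fs : seq S) : Prop :=
  (forall f, f \in fs -> irrelevant f) /\
  (forall i, (i < size fs)%N -> nzd_mod (add_elts I (take i fs)) (nth 0 fs i)) /\
  ~ add_elts I fs 1.

Definition depth (I : S -> Prop) (d : nat) : Prop :=
  (exists fs, regular_seq I fs /\ size fs = d) /\
  (forall fs, regular_seq I fs -> (size fs <= d)%N).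

Definition cohen_macaulay (I : S -> Prop) : Prop :=
  exists d, depth I d /\ krull_dim I d.

Definition CM_graph (e : rel 'I_n) : Prop := cohen_macaulay (edge_ideal e).

End CM.

(* Main.v *)
Require Import Defs.
From mathcomp Require Import all_boot all_order all_algebra.
From mathcomp Require Import mpoly ring.

(** Write [d] for the common value of depth and dimension of [S/I(G)].  If
[f] in the irrelevant ideal is regular on [S/J], it acts both injectively
(once the cohomology of [S/(J + f)] vanishes one degree lower) and nilpotently
on the Koszul cohomology of [S/J] with respect to the squares of the variables;
hence that cohomology vanishes for [J = I(G)] in degrees below [d].  A maximal
independent set [F] with [#|F| < d] gives the nonzero class of [x_F] in degree
[#|F|], while variable primes bound [d] from below, so all minimal covers have
[n - d] elements.  A matching of that size is then perfect, and every minimal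
cover meets each of its edges exactly once, which makes exchange edges lie in
every perfect matching and the exchange graph bipartite.  Conversely, given a
matching edge [{t, t'}], take [F] maximal such that [t |: F] and [t' |: F] are
both independent: if [#|F| = d - 1], these two sets exhibit an exchange, and
otherwise splitting the facets into those through [t] and those through [t']
gives a nonzero class in degree [#|F| + 1 < d]. *)

Set Implicit Arguments.
Unset Strict Implicit.
Unset Printing Implicit Defensive.

Import GRing.Theory.
Local Open Scope ring_scope.

(** * Koszul cochains *)

Section Koszul.
Variables (A : comNzRingType) (n : nat) (y : 'I_n -> A).
Implicit Types (c : {set 'I_n} -> A) (T : {set 'I_n}) (u v : 'I_n).

Definition ksign v T : A := (-1) ^+ #|[set u in T | (u < v)%N]|.

(** With [c T] read as the coefficient of e_T, this is exterior multiplication by the sum of the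
    [y v] e_v; [kcontr] is contraction against e_v. *)
Definition kdiff c T : A := \sum_(v in T) ksign v T * (y v * c (T :\ v)).

Definition kcontr v c T : A := if v \in T then 0 else ksign v T * c (v |: T).

Lemma ksign_sqr v T : ksign v T * ksign v T = 1.
Proof. by rewrite -expr2 sqrr_sign. Qed.

Lemma ksignD1 u v T : u \in T ->
  ksign v (T :\ u) = ksign v T * (-1) ^+ (u < v)%N.
Proof.
move=> uT; rewrite /ksign.
have -> : #|[set w in T | (w < v)%N]| =
          ((u < v)%N + #|[set w in T :\ u | (w < v)%N]|)%N.
  rewrite (cardsD1 u) inE uT /=; congr (_ + _)%N.
  by apply: eq_card => w; rewrite !inE andbA.
by rewrite exprD mulrAC -expr2 sqrr_sign mul1r.
Qed.

Lemma ksignU1 u v T : u \notin T ->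
  ksign v (u |: T) = ksign v T * (-1) ^+ (u < v)%N.
Proof.
move=> uT; have := @ksignD1 u v (u |: T); rewrite setU11 setU1K // => -> //.
by rewrite -mulrA -expr2 sqrr_sign mulr1.
Qed.

Lemma eq_kdiff c c' T : (forall v, v \in T -> c (T :\ v) = c' (T :\ v)) ->
  kdiff c T = kdiff c' T.
Proof. by move=> E; apply: eq_bigr => v vT; rewrite E. Qed.

Lemma kdiffD c c' T :
  kdiff (fun U => c U + c' U) T = kdiff c T + kdiff c' T.
Proof. by rewrite -big_split; apply: eq_bigr => v _ /=; rewrite !mulrDr. Qed.

Lemma kdiffB c c' T :
  kdiff (fun U => c U - c' U) T = kdiff c T - kdiff c' T.
Proof. by rewrite -sumrB; apply: eq_bigr => v _ /=; rewrite !mulrBr. Qed.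

Lemma kdiffM g c T : kdiff (fun U => g * c U) T = g * kdiff c T.
Proof.
by rewrite mulr_sumr; apply: eq_bigr => v _; rewrite !(mulrCA g).
Qed.

Lemma kdiff_kdiff c T : kdiff (kdiff c) T = 0.
Proof.
pose a u v := ksign u T * (y u * (ksign v (T :\ u) * (y v * c (T :\ u :\ v)))).
have -> : kdiff (kdiff c) T = \sum_(u in T) \sum_(v in T | v != u) a u v.
  apply: eq_bigr => u uT; rewrite !mulr_sumr.
  by apply: eq_bigl => v; rewrite !inE andbC.
(* Removing the smaller [u] flips the sign of [v], while removing [v] leaves the sign of [u]
   unchanged. *)
have anti u v : u \in T -> v \in T -> (u < v)%N -> a u v = - a v u.
  move=> uT vT uv; rewrite /a !ksignD1 // uv ltnNge ltnW //= expr1 mulr1.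
  by rewrite setDDl setUC -setDDl; ring.
have -> : \sum_(u in T) \sum_(v in T | v != u) a u v =
    \sum_(u in T) \sum_(v in T | (u < v)%N) a u v +
    \sum_(u in T) \sum_(v in T | (v < u)%N) a u v.
  rewrite -big_split; apply: eq_bigr => u uT /=.
  rewrite (bigID (fun v : 'I_n => (u < v)%N)) /=; congr (_ + _).
    apply: eq_bigl => v; rewrite -andbA; congr (_ && _).
    by case: eqVneq => [->|]; rewrite ?ltnn.
  apply: eq_bigl => v; rewrite -andbA; congr (_ && _).
  by rewrite -leqNgt [RHS]ltn_neqAle.
rewrite [X in _ + X](exchange_big_dep (mem T)) /=; last by move=> u v _ /andP[].
rewrite -big_split big1 // => u uT /=.
rewrite [X in _ + X](eq_bigl (fun v => (v \in T) && (u < v)%N)); last first.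
  by move=> v; rewrite uT.
by rewrite -big_split big1 // => v /andP[vT uv]; rewrite anti //= addNr.
Qed.

(** Contraction is a null-homotopy of multiplication by [y v]: apart from the term removing [v], the
    sign rules make everything vanish or cancel. *)
Lemma kcontr_homotopy v c T :
  kdiff (kcontr v c) T + kcontr v (kdiff c) T = y v * c T.
Proof.
rewrite {2}/kcontr; case: ifPn => vT.
  rewrite addr0 /kdiff (bigD1 v) //= big1 => [|u /andP[uT uv]].
    rewrite /kcontr !inE eqxx /= setD1K // ksignD1 // ltnn mulr1 addr0.
    by rewrite mulrCA !mulrA -(mulrA (y v)) ksign_sqr mulr1.
  by rewrite /kcontr !inE eq_sym uv vT !mulr0.
rewrite /kdiff big_setU1 //= mulrDr setU1K // ksignU1 // ltnn mulr1 mulrA.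
rewrite ksign_sqr mul1r addrCA mulr_sumr -big_split big1 ?addr0 //= => u uT.
have uv : u != v by apply: contraNneq vT => <-.
have -> : (v |: T) :\ u = v |: T :\ u.
  apply/setP=> w; rewrite !inE; case: (eqVneq w v) => [->|//].
  by rewrite eq_sym uv.
rewrite /kcontr !inE (negPf vT) andbF ksignU1 // ksignD1 //.
case: (ltngtP u v) => [_|_|/val_inj E]; last by rewrite E eqxx in uv.
all: by rewrite expr0 expr1; ring.
Qed.

End Koszul.

(** * Regular sequences and vanishing of Koszul cohomology *)

Section Ideals.
Variables (K : fieldType) (n : nat).
Local Notation S := {mpoly K[n]}.
Implicit Types (J : S -> Prop) (f g : S).

Lemma is_idealM J f g : is_ideal J -> J g -> J (f * g).
Proof. by case=> _ [_]; apply. Qed.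

Lemma is_ideal_sum J (X : Type) (r : seq X) (P : pred X) (F : X -> S) :
  is_ideal J -> (forall x, P x -> J (F x)) -> J (\sum_(x <- r | P x) F x).
Proof. by case=> J0 [JD _] H; apply: big_ind. Qed.

Lemma ideal_gen_is_ideal (B : S -> Prop) : is_ideal (ideal_gen B).
Proof.
split; first by exists [::]; split=> //; rewrite big_nil.
split=> [f g [s [Bs ->]] [s' [Bs' ->]] | f g [s [Bs ->]]].
  exists (s ++ s'); split; last by rewrite big_cat.
  by move=> p; rewrite mem_cat => /orP[/Bs|/Bs'].
exists [seq (f * p.1, p.2) | p <- s]; split.
  by move=> p /mapP[q /Bs Bq ->].
by rewrite big_map mulr_sumr; apply: eq_bigr => p _; rewrite mulrA.
Qed.

Lemma ideal_gen_sub (B : S -> Prop) g : B g -> ideal_gen B g.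
Proof.
move=> Bg; exists [:: (1, g)]; split; last by rewrite big_seq1 mul1r.
by move=> p; rewrite inE => /eqP ->.
Qed.

Lemma ideal_gen_min (B : S -> Prop) J : is_ideal J ->
  (forall g, B g -> J g) -> forall g, ideal_gen B g -> J g.
Proof.
move=> idJ BJ g [s [Bs ->]]; rewrite big_seq_cond.
by apply: is_ideal_sum => // p; rewrite andbT => /Bs/BJ; apply: is_idealM.
Qed.

Lemma add_elts_nil J : is_ideal J -> forall g, add_elts J [::] g <-> J g.
Proof.
move=> idJ g; split; last by move=> Jg; apply: ideal_gen_sub; left.
by apply: ideal_gen_min => // h [|//].
Qed.

(** Adjoining [f] last amounts to one further quotient by [f] alone, which allows induction along
    the sequence. *)
Lemma add_elts_rcons J fs f g : add_elts J (rcons fs f) g <->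
  exists q, add_elts J fs (g - q * f).
Proof.
have idJ : is_ideal (add_elts J fs) by exact: ideal_gen_is_ideal.
have [J0 [JD JM]] := idJ; split.
  apply: (ideal_gen_min (J := fun g => exists q, add_elts J fs (g - q * f))).
    split; first by exists 0; rewrite mul0r subr0.
    split=> [a b [q Hq] [q' Hq'] | a b [q Hq]].
      by exists (q + q'); rewrite mulrDl opprD addrACA; apply: JD.
    by exists (a * q); rewrite -mulrA -mulrBr; apply: JM.
  move=> h [Jh | ].
    by exists 0; rewrite mul0r subr0; apply: ideal_gen_sub; left.
  rewrite mem_rcons inE => /orP[/eqP-> | hfs].
    by exists 1; rewrite mul1r subrr.
  by exists 0; rewrite mul0r subr0; apply: ideal_gen_sub; right.
case=> q Hq; rewrite -(subrK (q * f) g).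
have [_ [J'D J'M]] := ideal_gen_is_ideal (fun g => J g \/ g \in rcons fs f).
apply: (J'D); last first.
  by apply: J'M; apply: ideal_gen_sub; right; rewrite mem_rcons mem_head.
apply: ideal_gen_min Hq => [|h Hh]; first exact: ideal_gen_is_ideal.
apply: ideal_gen_sub; case: Hh => [|hfs]; [by left | right].
by rewrite mem_rcons inE hfs orbT.
Qed.

(** Without constant term, every monomial of [f] contains a variable, hence has a power in [J]. For
    sums, each binomial term has a high enough exponent on one side. *)
Lemma irrelevant_radical J f : is_ideal J ->
  (forall i, exists N, J ('X_i ^+ N)) -> irrelevant f -> exists N, J (f ^+ N).
Proof.
move=> idJ HX f0; have [J0 [JD JM]] := idJ.
rewrite (mpolyE f) big_seq.
apply: (big_ind (fun g => exists N, J (g ^+ N))) => [|a b [N Ja] [M Jb]|m mf].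
- by exists 1%N; rewrite expr1.
- exists (N + M)%N; rewrite exprDn; apply: is_ideal_sum => // i _.
  rewrite -mulr_natl; apply: (JM); have [leMi|ltiM] := leqP M i.
    by rewrite -(subnK leMi) exprD mulrA; apply: JM.
  rewrite mulrC -(subnK (_ : N <= N + M - i)%N) 1?exprD 1?mulrA.
    exact: JM.
  by rewrite -addnBA ?leq_addr // ltnW.
have [i mi] : exists i, m i != 0%N.
  apply/existsP; apply: contraTT mf; rewrite negb_exists => /forallP m0.
  rewrite -mcoeff_eq0; apply/eqP; rewrite -[RHS]f0; congr (_@_ _).
  by apply/mnmP => i; rewrite mnm0E; apply/eqP; have := m0 i; rewrite negbK.
have [N HN] := HX i; exists N.
have -> : m = (U_(i) + (m - U_(i)))%MM.
  rewrite addmC submK //; apply/mnm_lepP => j; rewrite mnm1E.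
  by case: eqP => // <-; rewrite lt0n.
rewrite mpolyXD mulrC scalerAl exprMn; exact: JM.
Qed.

End Ideals.

(** * Koszul cohomology modulo an ideal *)

Section KoszulVanishing.
Variables (K : fieldType) (n : nat) (y : 'I_n -> {mpoly K[n]}).
Local Notation S := {mpoly K[n]}.
Implicit Types (J : S -> Prop) (d : nat) (c : {set 'I_n} -> S).

(** The differential at [T] sees [c] only on sets one smaller, so the bound [<= d] constrains
    exactly the components of degree below [d]. *)
Definition kcocycle J d c :=
  forall T : {set 'I_n}, (#|T| <= d)%N -> J (kdiff y c T).

Definition kcobound J d c :=
  exists b : {set 'I_n} -> S,
    forall T : {set 'I_n}, (#|T| < d)%N -> J (c T - kdiff y b T).

(* The Koszul cohomology of S/J vanishes in all degrees below d; all degrees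
   are handled at once by inhomogeneous cochains. *)
Definition kvanish J d := forall c, kcocycle J d c -> kcobound J d c.

Lemma kdiff_ideal J d c : is_ideal J ->
  (forall T : {set 'I_n}, (#|T| < d)%N -> J (c T)) -> kcocycle J d c.
Proof.
move=> idJ Jc T Td; apply: is_ideal_sum => // v vT.
do 2!apply: is_idealM => //; apply: Jc.
by rewrite (cardsD1 v T) vT in Td.
Qed.

Lemma kcocycleM J d c f : is_ideal J ->
  kcocycle J d c -> kcocycle J d (fun T => f * c T).
Proof. by move=> idJ Hc T Td; rewrite kdiffM; apply: is_idealM => //; apply: Hc. Qed.

(** The annihilator of the cohomology of S/J below degree [d]; being an ideal, it can be fed to
    [irrelevant_radical]. *)
Definition kannihilator J d (g : S) :=
  forall c, kcocycle J d c -> kcobound J d (fun T => g * c T).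

Lemma kannihilator_ideal J d : is_ideal J -> is_ideal (kannihilator J d).
Proof.
move=> idJ; have [J0 [JD JM]] := idJ; split.
  move=> c _; exists (fun=> 0) => T _; rewrite mul0r /kdiff big1 ?subr0 // => v _.
  by rewrite !mulr0.
split=> [f g Hf Hg | f g Hg] c Hc.
  have [b Hb] := Hf c Hc; have [b' Hb'] := Hg c Hc.
  exists (fun T => b T + b' T) => T Td.
  by rewrite kdiffD mulrDl opprD addrACA; apply: JD; [apply: Hb | apply: Hb'].
have [b Hb] := Hg c Hc; exists (fun T => f * b T) => T Td.
by rewrite kdiffM -mulrA -mulrBr; apply/JM/Hb.
Qed.

(** The homotopy is [kcontr v]. It uses the cocycle condition at [v |: T], one size up, which the
    gap between [<= d] and [< d] permits. *)
Lemma kannihilator_gen J d v : is_ideal J -> kannihilator J d (y v).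
Proof.
move=> idJ c Hc; exists (kcontr v c) => T Td.
rewrite -(kcontr_homotopy y) addrC addKr /kcontr; case: ifP => vT.
  by case: idJ.
by apply: is_idealM => //; apply: Hc; rewrite cardsU1 vT.
Qed.

(** This is the long exact sequence of multiplication by [f] on S/J, done by hand: [f] acts
    injectively by vanishing modulo [J'], and nilpotently by [annX]. *)
Lemma kvanish_step J J' d f : is_ideal J -> is_ideal J' ->
  (forall g, J' g <-> exists q, J (g - q * f)) -> nzd_mod J f ->
  (forall i, exists N, kannihilator J d.+1 ('X_i ^+ N)) -> irrelevant f ->
  kvanish J' d -> kvanish J d.+1.
Proof.
move=> idJ idJ' J'E fnzd annX f0 vanJ'; have [J0 [JD JM]] := idJ.
have JJ' g : J g -> J' g by move=> Jg; apply/J'E; exists 0; rewrite mul0r subr0.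
have divf c : kcocycle J d.+1 c ->
    kcobound J d.+1 (fun T => f * c T) -> kcobound J d.+1 c.
  move=> Hc [b Hb].
  (* Modulo [J], the differential of [b] is [f * c], a multiple of [f]. *)
  have Hb' : kcocycle J' d b.
    move=> T Td; apply/J'E; exists (c T).
    by rewrite -opprB mulrC -mulN1r; apply/JM/Hb.
  have [a Ha] := vanJ' _ Hb'.
  (* Lift the coboundary [b] from [J'] to [J]; the quotients by [f], chosen for each of the finitely
     many [T], form a cochain [g]. *)
  have [g Hg] : exists g : {ffun {set 'I_n} -> S}, forall T : {set 'I_n},
      (#|T| < d)%N -> J (b T - kdiff y a T - g T * f).
    have /fin_all_exists[g Hg] : forall T : {set 'I_n}, exists q,
        (#|T| < d)%N -> J (b T - kdiff y a T - q * f).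
      move=> T; have [Td|] := boolP (#|T| < d)%N; last by exists 0.
      by have /J'E[q Hq] := Ha T Td; exists q.
    by exists (finfun g) => T; rewrite ffunE; apply: Hg.
  (* Differentiating b = da + gf gives db = f dg modulo [J], so f (c - dg) lies in [J] and [f]
     cancels. *)
  exists g => T Td; apply: fnzd.
  have := kdiff_ideal idJ Hg Td.
  rewrite !kdiffB kdiff_kdiff subr0 => Hd.
  have -> : f * (c T - kdiff y g T) =
     (f * c T - kdiff y b T) + (kdiff y b T - kdiff y (fun U => g U * f) T).
    rewrite (eq_kdiff _ (c := fun U => g U * f) (c' := fun U => f * g U)).
      by rewrite kdiffM; ring.
    by move=> v _; rewrite mulrC.
  by apply: JD => //; apply: Hb.
(* A power of [f] annihilates the cohomology; [divf] then strips one factor at a time. *)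
have [N annf] := irrelevant_radical (kannihilator_ideal d.+1 idJ) annX f0.
move=> c Hc; move: (annf c Hc) => {annf}; elim: N => [|N IHN] cob.
  by case: cob => b Hb; exists b => T /Hb; rewrite expr0 mul1r.
apply: IHN; apply: divf; first exact: kcocycleM.
by case: cob => b Hb; exists b => T /Hb; rewrite exprS mulrA.
Qed.

(** Start from the full sequence, where degree 0 asks nothing; each element dropped from the end
    gains one degree of vanishing. *)
Lemma regular_seq_kvanish J fs : is_ideal J ->
  (forall i, exists N, y i = 'X_i ^+ N) ->
  regular_seq J fs -> kvanish J (size fs).
Proof.
move=> idJ yX [firr [fnzd _]].
have idA s : is_ideal (add_elts J s) by exact: ideal_gen_is_ideal.
have van k : (k <= size fs)%N ->
    kvanish (add_elts J (take (size fs - k) fs)) k.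
  elim: k => [_|k IHk ltk]; first by move=> c _; exists (fun=> 0).
  set i := (size fs - k.+1)%N.
  have lti : (i < size fs)%N by rewrite ltn_subrL (leq_trans _ ltk).
  apply: (@kvanish_step _ (add_elts J (take (size fs - k) fs)) _ (nth 0 fs i)) => //.
  - by move=> g; rewrite -(subnSK ltk) -/i (take_nth 0) //; apply: add_elts_rcons.
  - exact: fnzd.
  - by move=> v; have [N yN] := yX v; exists N; rewrite -yN; apply: kannihilator_gen.
  - by apply: firr; apply: mem_nth.
  - by apply: IHk; apply: ltnW.
have := van _ (leqnn _); rewrite subnn take0 => van0 c Hc.
have [|b Hb] := van0 c; first by move=> T Td; apply/(add_elts_nil idJ)/Hc.
by exists b => T Td; apply/(add_elts_nil idJ)/Hb.
Qed.

End KoszulVanishing.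

(** * Edge ideals *)

Section VariablePrimes.
Variables (K : fieldType) (n : nat).
Local Notation S := {mpoly K[n]}.

Definition kill_vars (C : {set 'I_n}) (f : S) : S :=
  f \mPo [tuple if i \in C then 0 else 'X_i | i < n].

(** The ideal generated by the variables in [C], taken as a kernel so that primality follows from S
    being a domain. *)
Definition vars_prime (C : {set 'I_n}) (f : S) : Prop := kill_vars C f = 0.

Lemma kill_varsX C i : kill_vars C 'X_i = if i \in C then 0 else 'X_i.
Proof. by rewrite /kill_vars comp_mpolyXU -tnth_nth tnth_mktuple. Qed.

Lemma kill_varsM C f g : kill_vars C (f * g) = kill_vars C f * kill_vars C g.
Proof. exact: rmorphM. Qed.

Lemma kill_vars_sub (C D : {set 'I_n}) f :
  C \subset D -> kill_vars D (kill_vars C f) = kill_vars D f.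
Proof.
move=> /subsetP CD; rewrite {1}/kill_vars [kill_vars C f]comp_mpolyEX.
rewrite linear_sum [RHS]comp_mpolyEX /=.
apply: eq_bigr => m _; rewrite comp_mpolyZ; congr (_ *: _).
rewrite !comp_mpolyX rmorph_prod; apply: eq_bigr => i _ /=.
rewrite rmorphXn /= !tnth_mktuple; congr (_ ^+ _).
case: ifP => iC; first by rewrite (CD _ iC) comp_mpoly0.
by rewrite comp_mpolyXU -tnth_nth tnth_mktuple.
Qed.

Lemma vars_prime_prime C : prime_ideal (vars_prime C).
Proof.
split; last split.
- split; first exact: comp_mpoly0.
  split=> [f g Hf Hg|f g Hg]; last by rewrite /vars_prime kill_varsM Hg mulr0.
  by rewrite /vars_prime [LHS]comp_mpolyD -/(kill_vars C f) Hf add0r.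
- by rewrite /vars_prime /kill_vars comp_mpoly1; apply/eqP/oner_neq0.
move=> f g; rewrite /vars_prime kill_varsM => /eqP.
by rewrite mulf_eq0 => /orP[]/eqP; [left|right].
Qed.

Lemma vars_prime_strict (C D : {set 'I_n}) :
  C \proper D -> subset_strict (vars_prime C) (vars_prime D).
Proof.
case/properP => CD [i iD iC]; split.
  by move=> f Hf; rewrite /vars_prime -(kill_vars_sub _ CD) Hf; apply: comp_mpoly0.
exists 'X_i; rewrite /vars_prime !kill_varsX iD (negPf iC); split=> // /eqP.
by rewrite -msize_poly_eq0 msizeX.
Qed.

End VariablePrimes.

(** * Koszul classes of independent sets and the dimension bound *)

Section EdgeIdeal.
Variables (K : fieldType) (n : nat) (e : rel 'I_n).
Hypothesis e_irr : irreflexive e.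
Local Notation S := {mpoly K[n]}.
Local Notation I := (edge_ideal e : S -> Prop).
Implicit Types (F T C : {set 'I_n}) (m : 'X_{1..n}).

Definition independent F := [forall x in F, forall y in F, ~~ e x y].

Lemma independentP F :
  reflect (forall x y, x \in F -> y \in F -> ~~ e x y) (independent F).
Proof.
apply: (iffP 'forall_in_'forall_in_idP) => H x y; first by move=> /H; apply.
by move=> xF yF; apply: H.
Qed.

Lemma independentPn F :
  reflect (exists x y, [/\ x \in F, y \in F & e x y]) (~~ independent F).
Proof.
apply: (iffP idP) => [|[x [y [xF yF exy]]]].
  rewrite negb_forall_in => /exists_inP[x xF].
  rewrite negb_forall_in => /exists_inP[y yF]; rewrite negbK => exy.
  by exists x, y.
by apply/negP => /independentP/(_ x y xF yF); rewrite exy.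
Qed.

Lemma independentS F T : F \subset T -> independent T -> independent F.
Proof.
move=> /subsetP FT /independentP H; apply/independentP => x y /FT xT /FT yT.
exact: H.
Qed.

Lemma independent_cover F : independent F = vertex_cover e (~: F).
Proof.
apply/independentP/forallP => [H x|H x y xF yF].
  apply/forallP => y; apply/implyP => exy; rewrite !inE -negb_and.
  by apply/negP => /andP[xF yF]; have := H x y xF yF; rewrite exy.
apply/negP => exy; have /forallP/(_ y) := H x.
by rewrite exy !inE xF yF.
Qed.

Lemma edge_ideal_ideal : is_ideal I.
Proof. exact: ideal_gen_is_ideal. Qed.

(** Every monomial occurring in a multiple of a generator has an edge in its support. This is the
    test that shows classes to be nonzero. *)
Lemma edge_ideal_coeff (f : S) m :
  I f -> independent [set i | m i != 0%N] -> f@_m = 0.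
Proof.
move=> If; move: m; apply: (ideal_gen_min
  (J := fun f : S => forall m, independent [set i | m i != 0%N] -> f@_m = 0)) If.
  split=> [m _|]; first by rewrite mcoeff0.
  split=> [a b Ha Hb m Hm|a b Hb m Hm]; first by rewrite mcoeffD Ha ?Hb ?addr0.
  rewrite mcoeffM big1 // => k /eqP Ek; rewrite Hb ?mulr0 //.
  apply: independentS Hm; apply/subsetP => i.
  rewrite !inE (congr1 (fun x : 'X_{1..n} => x i) Ek) mnmDE addn_eq0.
  by rewrite negb_and orbC => ->.
move=> g [i [j [eij ->]]] m /independentP H; rewrite -mpolyXD mcoeffX.
case: eqP => // Em; suff : ~~ e i j by rewrite eij.
by apply: H; rewrite inE -Em mnmDE !mnm1E eqxx ?addn1.
Qed.

Lemma edge_ideal_mono m i j :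
  e i j -> m i != 0%N -> m j != 0%N -> I 'X_[m].
Proof.
move=> eij mi mj; have ij : i != j by apply: contraTneq eij => ->; rewrite e_irr.
have le_m : (U_(i) + U_(j) <= m)%MM.
  apply/mnm_lepP => k; rewrite mnmDE !mnm1E.
  case: (eqVneq i k) => [<-|_]; last by case: eqP => // <-; rewrite lt0n.
  by rewrite eq_sym (negPf ij) addn0 lt0n.
rewrite -(submK le_m) mpolyXD; apply: (is_idealM _ edge_ideal_ideal).
by apply: ideal_gen_sub; exists i, j; rewrite mpolyXD.
Qed.

Definition sqf F : 'X_{1..n} := [multinom (i \in F : nat) | i < n].

Lemma supp_sqf F : [set i | sqf F i != 0%N] = F.
Proof. by apply/setP => i; rewrite inE mnmE; case: (i \in F). Qed.

(** Squares are used because a multiple of [y i] has no monomial of exponent below 2 at [i], so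
    squarefree monomials never occur in coboundaries. *)
Let y (i : 'I_n) : S := 'X_i ^+ 2.

Lemma mcoeff_sqX i (g : S) m : (m i < 2)%N -> (y i * g)@_m = 0.
Proof.
move=> mi; rewrite /y mpolyXn mcoeffM big1 // => k /eqP Em.
rewrite mcoeffX; case: eqP => [Ek|]; last by rewrite mul0r.
move: mi; rewrite (congr1 (fun x : 'X_{1..n} => x i) Em) mnmDE.
by rewrite -Ek mulmnE mnm1E eqxx.
Qed.

Lemma mcoeff_kdiff_sqf F b : (kdiff y b F)@_(sqf F) = 0.
Proof.
rewrite /kdiff raddf_sum big1 // => i _ /=.
by rewrite mulrCA mcoeff_sqX // mnmE; case: (i \in F).
Qed.

Lemma ksignMcoeff v T (g : S) m :
  (ksign S v T * g)@_m = ksign K v T * g@_m.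
Proof.
rewrite /ksign -(signr_odd S) -(signr_odd K); case: (odd _).
  by rewrite !expr1 !mulN1r mcoeffN.
by rewrite !expr0 !mul1r.
Qed.

(** The monomial has exponent 1 at each vertex of [F], so only the term removing [v] contributes.
    Different [v] thus read off the same coefficient of [b F]. *)
Lemma mcoeff_kdiff_sqfU1 F v b : v \notin F ->
  (kdiff y b (v |: F))@_(U_(v) *+ 2 + sqf F) =
  ksign K v (v |: F) * (b F)@_(sqf F).
Proof.
move=> vF; rewrite /kdiff raddf_sum /= big_setU1 //= setU1K // ksignMcoeff.
rewrite [y v * _]mulrC /y mpolyXn mcoeffMX big1 ?addr0 // => i iF.
rewrite mulrCA mcoeff_sqX // mnmDE mulmnE mnm1E mnmE iF.
by case: eqP => // E; rewrite E iF in vF.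
Qed.

Definition face_cochain F (T : {set 'I_n}) : S :=
  if T == F then 'X_[sqf F] else 0.

Lemma kdiff_face_mem F T : ~~ independent T -> I (kdiff y (face_cochain F) T).
Proof.
case/independentPn => i [j [iT jT eij]].
apply: is_ideal_sum => [|v vT]; first exact: edge_ideal_ideal.
rewrite /face_cochain; case: eqP => [TF|_]; last first.
  by rewrite !mulr0; case: edge_ideal_ideal.
apply: (is_idealM _ edge_ideal_ideal); rewrite /y mpolyXn -mpolyXD.
by apply: (edge_ideal_mono eij); rewrite mnmDE mulmnE mnm1E mnmE -TF !inE ?iT ?jT;
   case: (eqVneq v).
Qed.

(** In a nonzero term, [T] is [F] with [u] and [v] added, so the support of its monomial is [T] and
    contains an edge. *)
Lemma kdiff_face_mulmem F T u : u \in T -> ~~ independent T ->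
  I (y u * kdiff y (face_cochain F) (T :\ u)).
Proof.
move=> uT /independentPn[i [j [iT jT eij]]].
rewrite mulr_sumr; apply: is_ideal_sum => [|v vT]; first exact: edge_ideal_ideal.
rewrite /face_cochain; case: eqP => [TF|_]; last first.
  by rewrite !mulr0; case: edge_ideal_ideal.
rewrite mulrCA; apply: (is_idealM _ edge_ideal_ideal).
rewrite /y !mpolyXn -!mpolyXD.
by apply: (edge_ideal_mono eij);
  rewrite mnmDE mulmnE mnmDE mulmnE !mnm1E mnmE -TF !inE ?iT ?jT;
  case: (eqVneq u); case: (eqVneq v).
Qed.

(** Adding any vertex to [F] creates an edge, so x_F e_F is a cocycle. Coboundaries at [F] have
    coefficient 0 at x_F, so it would be a nonzero class in degree [#|F|]. *)
Lemma maximal_independent_card d F : kvanish y I d ->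
  independent F -> (forall v, v \notin F -> ~~ independent (v |: F)) ->
  (d <= #|F|)%N.
Proof.
move=> van indF maxF; rewrite leqNgt; apply/negP => ltFd.
have [|b /(_ F ltFd)] := van (face_cochain F).
  move=> T _; have [/exists_inP[v vT /eqP TF]|noF] :=
    boolP [exists v in T, T :\ v == F].
    apply: kdiff_face_mem; rewrite -(setD1K vT) TF; apply: maxF.
    by rewrite -TF !inE eqxx.
  rewrite /kdiff big1; first by case: edge_ideal_ideal.
  move=> v vT; rewrite /face_cochain; case: ifP => TF; last by rewrite !mulr0.
  by case/negP: noF; apply/exists_inP; exists v.
move=> HF; have := edge_ideal_coeff (m := sqf F) HF; rewrite supp_sqf.
move=> /(_ indF) /eqP.
rewrite mcoeffB mcoeff_kdiff_sqf /face_cochain eqxx mcoeffX eqxx subr0.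
by rewrite oner_eq0.
Qed.

(* The cochain is the product of [kdiff (face_cochain F)] with the idempotent
   that is 0 on the facets through t and 1 on those through t'. *)
Lemma separating_face_card d F t t' : kvanish y I d ->
  t \notin F -> t' \notin F -> e t t' ->
  independent (t |: F) -> independent (t' |: F) ->
  (forall v, v \notin F ->
     ~~ (independent (t |: (v |: F)) && independent (t' |: (v |: F)))) ->
  (forall T, independent T -> independent (t |: T) || independent (t' |: T)) ->
  (d <= #|F|.+1)%N.
Proof.
move=> van tF t'F ett' indt indt' maxF facets; rewrite leqNgt; apply/negP => ltFd.
pose c0 := kdiff y (face_cochain F).
pose c T := if independent (t |: T) then 0 else c0 T.
have I0 : I 0 by case: edge_ideal_ideal.
have [|b Hb] := van c.
  move=> T _; have [indT|depT] := boolP (independent T); last first.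
    apply: is_ideal_sum => [|u uT]; first exact: edge_ideal_ideal.
    apply: (is_idealM _ edge_ideal_ideal); rewrite /c.
    by case: ifP => _; [rewrite mulr0 | apply: kdiff_face_mulmem].
  have [indtT|] := boolP (independent (t |: T)).
    rewrite /kdiff big1 // => u uT; rewrite /c ifT ?mulr0 //.
    by apply: independentS indtT; apply: setUS; apply: subsetDl.
  move=> ntT; have indt'T : independent (t' |: T).
    by have := facets T indT; rewrite (negPf ntT).
  (* Where [c] was set to 0, [c0] vanishes too: a nonzero term needs [T :\ u] to be [v |: F],
     compatible with both [t] and [t'], against maximality of [F]. *)
  rewrite (eq_kdiff _ (c' := c0)) ?kdiff_kdiff // => u uT; rewrite /c.
  case: ifP => // indtTu; symmetry; rewrite /c0 /kdiff big1 // => v vT.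
  rewrite /face_cochain; case: eqP => [TF|]; last by rewrite !mulr0.
  have vF : v \notin F by rewrite -TF !inE eqxx.
  have /negP[] := maxF v vF; rewrite -TF setD1K // indtTu.
  by apply: independentS indt'T; apply: setUS; apply: subsetDl.
have sgn0 v : ksign K v (v |: F) != 0 by rewrite signr_eq0.
have supp2 v : v \notin F ->
    [set i | (U_(v) *+ 2 + sqf F)%MM i != 0%N] = v |: F.
  move=> vF; apply/setP => i; rewrite !inE mnmDE mulmnE mnm1E mnmE.
  by rewrite (eq_sym i); case: (v == i); case: (i \in F).
(* Since [c] is 0 on [t |: F], the coefficient of x_F in [b F] must vanish. *)
have := Hb (t |: F); rewrite cardsU1 tF => /(_ ltFd) Ht.
have := edge_ideal_coeff (m := (U_(t) *+ 2 + sqf F)%MM) Ht.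
rewrite supp2 // => /(_ indt); rewrite /c setUA setUid indt sub0r mcoeffN.
rewrite mcoeff_kdiff_sqfU1 // => /eqP; rewrite oppr_eq0 mulf_eq0 (negPf (sgn0 t)) /=.
move=> /eqP bF0.
(* On [t' |: F] the cochain is [c0], which forces that same coefficient to be 1. *)
have := Hb (t' |: F); rewrite cardsU1 t'F => /(_ ltFd) Ht'.
have := edge_ideal_coeff (m := (U_(t') *+ 2 + sqf F)%MM) Ht'.
rewrite supp2 // => /(_ indt'); rewrite /c ifN; last first.
  by apply/independentPn; exists t, t'; rewrite !inE !eqxx orbT.
rewrite mcoeffB !mcoeff_kdiff_sqfU1 // bF0 mulr0 subr0 /face_cochain eqxx mcoeffX eqxx.
by rewrite mulr1 => /eqP; apply/negP.
Qed.

(** The chain starts at the prime of [C] and adds the remaining variables one by one. *)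
Lemma cover_krull_dim C d : vertex_cover e C ->
  krull_dim I d -> (n - #|C| <= d)%N.
Proof.
move=> covC [_ maxd].
pose Q i := C :|: [set x in take i (enum (~: C))].
pose c := mkseq (fun i => vars_prime (K := K) (Q i)) (n - #|C|).+1.
have sz : size (enum (~: C)) = (n - #|C|)%N by rewrite -cardE cardsCs setCK card_ord.
suff : prime_chain I c by move/maxd; rewrite size_mkseq.
split; first by rewrite size_mkseq.
split=> i; rewrite size_mkseq => lti; rewrite !nth_mkseq //; last exact: ltnW.
  split; first exact: vars_prime_prime.
  have [idQ _] := @vars_prime_prime K n (Q i).
  apply: ideal_gen_min => // g [u [v [euv ->]]].
  rewrite /vars_prime kill_varsM !kill_varsX !in_setU.
  have /forallP/(_ u)/forallP/(_ v) := covC; rewrite euv /=.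
  by case/orP => -> /=; rewrite ?mul0r ?mulr0.
apply: vars_prime_strict; rewrite ltnS -sz in lti.
have [x0 _] : exists x : 'I_n, x \in enum (~: C).
  by case: (enum (~: C)) lti => // x s _; exists x; apply: mem_head.
rewrite /Q (take_nth x0) //; apply/properP; split.
  by apply: setUS; apply/subsetP => x; rewrite !inE mem_rcons inE => ->; rewrite orbT.
exists (nth x0 (enum (~: C)) i); rewrite !inE ?mem_rcons ?mem_head ?orbT //.
rewrite negb_or; apply/andP; split.
  by have := mem_nth x0 lti; rewrite mem_enum inE.
have := enum_uniq (mem (~: C)); rewrite -{1}(cat_take_drop i (enum (~: C))).
rewrite cat_uniq => /and3P[_ /hasPn H _]; apply: H.
by rewrite (drop_nth x0) // mem_head.
Qed.

End EdgeIdeal.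

(** * Minimal vertex covers and matchings *)

Section Covers.
Variables (n : nat) (e : rel 'I_n).
Hypotheses (e_sym : ssrbool.symmetric e) (e_irr : irreflexive e).
Implicit Types (C D E F T : {set 'I_n}) (M Q : {set {set 'I_n}}).

Lemma vertex_coverP C :
  reflect (forall x y, e x y -> x \notin C -> y \in C) (vertex_cover e C).
Proof.
apply: (iffP 'forall_'forall_implyP) => H x y exy.
  by move=> xC; have := H x y exy; rewrite (negPf xC).
by have := H x y exy; case: (x \in C) => //=; apply.
Qed.

Lemma min_cover_sub C :
  vertex_cover e C -> exists2 D, min_vertex_cover e D & D \subset C.
Proof. by case/minset_exists => D; exists D. Qed.

Lemma min_cover_cover C : min_vertex_cover e C -> vertex_cover e C.
Proof. exact: minsetp. Qed.

Lemma min_cover_maximal_independent C v :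
  min_vertex_cover e C -> v \in C -> ~~ independent e (v |: ~: C).
Proof.
move=> minC vC; rewrite independent_cover setCU setCK; apply/negP => cov.
have /setP/(_ v) := minsetinf minC cov (subsetIr _ _).
by rewrite !inE eqxx vC.
Qed.

(** Without loops, all vertices but [y] form a cover; a minimal cover inside it misses [y] and so
    contains [x]. *)
Lemma neighbor_min_cover x y : e x y ->
  exists C, [/\ min_vertex_cover e C, x \in C & y \notin C].
Proof.
move=> exy; have [|C minC CT] := @min_cover_sub (~: [set y]).
  apply/vertex_coverP => a b eab; rewrite !inE negbK => /eqP Ea.
  by apply: contraTneq eab => ->; rewrite Ea e_irr.
have yC : y \notin C.
  by apply/negP => /(subsetP CT); rewrite !inE eqxx.
exists C; split=> //.
by apply: (vertex_coverP _ (min_cover_cover minC) y); rewrite // e_sym.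
Qed.

Lemma matchingP M : reflect ((forall E, E \in M -> is_edge e E) /\
  {in M &, forall E F, E != F -> [disjoint E & F]}) (matching e M).
Proof.
apply: (iffP andP) => [[H1 H2]|[H1 H2]]; split.
- exact/forall_inP.
- move=> E F EM FM EF; have /forall_inP/(_ E EM)/forall_inP/(_ F FM) := H2.
  by rewrite EF.
- exact/forall_inP.
apply/forall_inP => E EM; apply/forall_inP => F FM; apply/implyP; exact: H2.
Qed.

Lemma matching_trivI M : matching e M -> trivIset M.
Proof. by case/matchingP => _ H; apply/trivIsetP => E F EM FM; apply: H. Qed.

Lemma edgeP E : reflect (exists x y, e x y /\ E = [set x; y]) (is_edge e E).
Proof.
apply: (iffP existsP) => [[x /existsP[y /andP[exy /eqP ->]]]|[x [y [exy ->]]]].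
  by exists x, y.
by exists x; apply/existsP; exists y; rewrite exy eqxx.
Qed.

Lemma adj_neq x y : e x y -> x != y.
Proof. by apply: contraTneq => ->; rewrite e_irr. Qed.

Lemma card_edge E : is_edge e E -> #|E| = 2%N.
Proof. by case/edgeP => x [y [exy ->]]; rewrite cards2 adj_neq. Qed.

Lemma matching_block_eq M E F x :
  matching e M -> E \in M -> F \in M -> x \in E -> x \in F -> E = F.
Proof.
case/matchingP => _ H EM FM xE xF; apply/eqP.
have := H E F EM FM; case: eqVneq => // _ /(_ isT).
by rewrite -setI_eq0 => /eqP/setP/(_ x); rewrite !inE xE xF.
Qed.

Lemma perfect_matching_mem Q x :
  perfect_matching e Q -> exists y, e x y /\ [set x; y] \in Q.
Proof.
case/andP => matQ /forallP/(_ x)/exists_inP[E EQ xE].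
have [/(_ E EQ)/edgeP[a [b [eab Eab]]] _] := matchingP _ matQ.
move: xE EQ; rewrite Eab !inE => /orP[]/eqP-> EQ; first by exists b.
by exists a; rewrite e_sym setUC.
Qed.

Lemma card_perfect_matching Q : perfect_matching e Q -> (#|Q| * 2)%N = n.
Proof.
move=> pQ; have /andP[matQ _] := pQ.
have := matching_trivI matQ; rewrite /trivIset => /eqP.
have -> : cover Q = setT.
  apply/setP => x; rewrite inE; have [y [_ yQ]] := perfect_matching_mem x pQ.
  by apply/bigcupP; exists [set x; y]; rewrite // !inE eqxx.
rewrite cardsT card_ord => En; rewrite -[RHS]En -sum_nat_const.
apply: eq_bigr => E EQ; rewrite card_edge //.
by have [H _] := matchingP _ matQ; apply: H.
Qed.

Lemma card_cover_matching C M : matching e M ->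
  (\sum_(E in M) #|C :&: E| + #|C :\: cover M| = #|C|)%N.
Proof.
move=> matM; rewrite -(cardsID (cover M) C); congr (_ + _)%N.
transitivity (\sum_(E in M) \sum_(x in E) (x \in C : nat))%N.
  apply: eq_bigr => E _; rewrite -sum1_card big_mkcond [RHS]big_mkcond /=.
  by apply: eq_bigr => x _; rewrite inE andbC; case: (x \in E) (x \in C) => [] [].
rewrite -big_trivIset ?matching_trivI // -sum1_card big_mkcond [RHS]big_mkcond /=.
by apply: eq_bigr => x _; rewrite inE andbC; case: (x \in cover M) (x \in C) => [] [].
Qed.

Lemma cover_meets_edge C E : vertex_cover e C -> is_edge e E -> (0 < #|C :&: E|)%N.
Proof.
move=> /vertex_coverP covC /edgeP[x [y [exy ->]]]; apply/card_gt0P.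
have [xC|xC] := boolP (x \in C); first by exists x; rewrite !inE xC eqxx.
by exists y; rewrite !inE eqxx orbT andbT; apply: covC xC.
Qed.

(** Disjoint edges each need their own vertex of [C], so [#|C| <= #|M|] leaves no room for a second
    vertex on an edge or an unmatched one. *)
Lemma tight_cover C M : vertex_cover e C -> matching e M -> (#|C| <= #|M|)%N ->
  C \subset cover M /\ forall E, E \in M -> #|C :&: E| = 1%N.
Proof.
move=> covC matM leCM; have := card_cover_matching C matM.
have [edM _] := matchingP _ matM.
have ge1 E : E \in M -> (1 <= #|C :&: E|)%N.
  by move=> EM; apply: cover_meets_edge => //; apply: edM.
have leM : (#|M| <= \sum_(E in M) #|C :&: E|)%N.
  by rewrite -sum1_card; apply: leq_sum.
move=> Esum; split.
  rewrite -setD_eq0 -cards_eq0 -leqn0 -(leq_add2l (\sum_(E in M) #|C :&: E|)).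
  by rewrite Esum addn0 (leq_trans leCM).
move=> E EM; apply/eqP; rewrite eqn_leq ge1 // andbT.
have leM' : (#|M :\ E| <= \sum_(F in M | F != E) #|C :&: F|)%N.
  rewrite -sum1_card (eq_bigl (fun F => (F \in M) && (F != E))).
    by apply: leq_sum => F /andP[FM _]; apply: ge1.
  by move=> F; rewrite !inE andbC.
rewrite -(leq_add2r #|M :\ E|).
apply: leq_trans (leq_add (leqnn _) leM') _.
rewrite -[X in (X <= _)%N](bigD1 E) //=.
have -> : (1 + #|M :\ E| = #|M|)%N by rewrite (cardsD1 E M) EM.
by apply: leq_trans leCM; rewrite -Esum leq_addr.
Qed.

End Covers.

(** * Unmixed graphs: perfect matchings and exchanges *)

Section Unmixed.
Variables (n : nat) (e : rel 'I_n) (h : nat).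
Hypotheses (e_sym : ssrbool.symmetric e) (e_irr : irreflexive e).
Hypothesis unmixed : forall C, min_vertex_cover e C -> #|C| = h.
Implicit Types (C D E F T : {set 'I_n}) (M Q : {set {set 'I_n}}).

Lemma unmixed_cover_ge C : vertex_cover e C -> (h <= #|C|)%N.
Proof.
by case/min_cover_sub => D minD DC; rewrite -(unmixed minD) subset_leq_card.
Qed.

Lemma unmixed_cover_min C :
  vertex_cover e C -> (#|C| <= h)%N -> min_vertex_cover e C.
Proof.
move=> covC leCh; have [D minD DC] := min_cover_sub covC.
suff -> : C = D by [].
by apply/eqP; rewrite eq_sym eqEcard DC (unmixed minD).
Qed.

Lemma unmixed_alpha0_ge : (h <= alpha0 e)%N.
Proof.
apply: (big_ind (leq h)) => [|a b|C]; last exact: unmixed_cover_ge.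
  (* The default value [n] of the minimum is the size of the cover by all vertices. *)
  rewrite -[leqRHS]card_ord -cardsT; apply: unmixed_cover_ge.
  by apply/vertex_coverP => x y _; rewrite !inE.
by rewrite leq_min => -> ->.
Qed.

(** The König matching is tight for every minimal cover, and without isolated vertices every vertex
    lies in some minimal cover. *)
Lemma Konig_unmixed_perfect : no_isolated e -> Konig e ->
  exists2 M, perfect_matching e M & (h * 2 <= n)%N.
Proof.
move=> noiso [M [matM cardM]].
have leM : (h <= #|M|)%N by rewrite cardM unmixed_alpha0_ge.
have perM : perfect_matching e M.
  apply/andP; split=> //; apply/forallP => x.
  have [y exy] := noiso x.
  have [C [minC xC _]] := neighbor_min_cover e_sym e_irr exy.
  have [|CM _] := tight_cover (min_cover_cover minC) matM; first by rewrite unmixed.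
  have /bigcupP[E EM xE] := subsetP CM x xC.
  by apply/exists_inP; exists E.
by exists M; rewrite // -[leqRHS](card_perfect_matching e_sym e_irr perM) leq_mul2r.
Qed.

Hypothesis le_h2n : (h * 2 <= n)%N.

(** Any perfect matching has n/2 edges, at least [h] by [le_h2n], so it is tight for every minimal
    cover. *)
Lemma min_cover_perfect_edge C Q E : min_vertex_cover e C ->
  perfect_matching e Q -> E \in Q -> #|C :&: E| = 1%N.
Proof.
move=> minC perQ; have /andP[matQ _] := perQ.
have [|_] := tight_cover (min_cover_cover minC) matQ; last exact.
rewrite unmixed // -(leq_pmul2r (_ : 0 < 2)%N) //.
by rewrite (card_perfect_matching e_sym e_irr perQ).
Qed.

Lemma min_cover_perfect_pair C Q x y : min_vertex_cover e C ->
  perfect_matching e Q -> [set x; y] \in Q -> e x y -> (x \in C) = (y \notin C).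
Proof.
move=> minC perQ xyQ exy; have := min_cover_perfect_edge minC perQ xyQ.
have xy := adj_neq e_irr exy.
rewrite (cardsD1 x) (cardsD1 y) !inE !eqxx (eq_sym y) xy /= orbT !andbT.
rewrite (_ : _ :\ x :\ y = set0) ?cards0; last first.
  by apply/setP => z; rewrite !inE; case: eqP; case: eqP; rewrite ?andbF.
by case: (x \in C); case: (y \in C).
Qed.

(** The partner of [t] in [Q] is outside [C] but inside [D], and [t'] is the only such vertex. *)
Lemma swap_in_perfect C D Q t t' : min_vertex_cover e C -> min_vertex_cover e D ->
  perfect_matching e Q -> t \in C -> D = (C :\ t) :|: [set t'] ->
  t \notin D -> [set t; t'] \in Q.
Proof.
move=> minC minD perQ tC DE tD.
have [s [ets tsQ]] := perfect_matching_mem e_sym t perQ.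
have sC := min_cover_perfect_pair minC perQ tsQ ets.
have := min_cover_perfect_pair minD perQ tsQ ets.
rewrite tC in sC; rewrite (negPf tD) DE !inE (negPf (esym sC)) andbF /=.
by move/esym/negbFE/eqP => <-.
Qed.

Lemma exchange_edges_sub_perfect Q :
  perfect_matching e Q -> exchange_edges e \subset Q.
Proof.
move=> perQ; apply/subsetP => E; rewrite inE.
case/existsP => t /existsP[t' /and3P[ett' /eqP->]].
case/existsP => C /existsP[D /and4P[minC minD CD /eqP DE]].
have tt' := adj_neq e_irr ett'.
have cCD : #|C| = #|D| by rewrite !unmixed.
have tD : t \notin D by rewrite DE !inE eqxx (negPf tt').
(* If [t] were outside [C], then [C] would lie in [D], and equal sizes would make them equal. *)
apply: (swap_in_perfect minC minD perQ _ DE tD).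
apply: contraNT CD => tC; rewrite eqEcard cCD leqnn andbT DE.
by apply/subsetP => x xC; rewrite !inE xC andbT (contraNneq _ tC) // => <-.
Qed.

Lemma Ic_adj_swap C D : Ic_adj e C D -> exists t t',
  [/\ t \in C, t \notin D, t' \notin C & D = (C :\ t) :|: [set t']].
Proof.
case/and4P => minC minD CD /eqP cU.
have cCD : #|C| = #|D| by rewrite !unmixed.
have cI : #|C :&: D|.+1 = #|D|.
  by apply/(@addnI #|C|); rewrite -addSnnS -cU cardsUI.
have /eqP/cards1P[t' Et'] : #|D :\: C| = 1%N.
  by apply/(@addnI #|D :&: C|); rewrite cardsID setIC addn1 cI.
have /eqP/cards1P[t Et] : #|C :\: D| = 1%N.
  by apply/(@addnI #|C :&: D|); rewrite cardsID addn1 cI.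
have memt : t \in C :\: D by rewrite Et inE.
have memt' : t' \in D :\: C by rewrite Et' inE.
move: memt memt'; rewrite !inE => /andP[tD tC] /andP[t'C t'D].
exists t, t'; split=> //; apply/setP => x.
move/setP/(_ x): Et; move/setP/(_ x): Et'; rewrite !inE => <- <-.
by case: (x \in C); case: (x \in D).
Qed.

(** [V] collects the smaller endpoint of each edge of [Q]. Adjacent covers differ by a swap along
    one edge of [Q], which changes the parity of [#|C :&: V|]. *)
Lemma Ic_bipartite_of_perfect Q : perfect_matching e Q -> Ic_bipartite e.
Proof.
move=> perQ; have /andP[matQ _] := perQ.
pose V := [set x : 'I_n | [exists y : 'I_n, (x < y)%N && ([set x; y] \in Q)]].
have VE x y : e x y -> [set x; y] \in Q -> (x \in V) = (x < y)%N.
  move=> exy xyQ; rewrite inE; apply/existsP/idP => [[z /andP[xz xzQ]]|xy].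
    have /setP/(_ z) : [set x; z] = [set x; y].
      by apply: (matching_block_eq matQ (x := x)); rewrite // !inE eqxx.
    rewrite !inE eqxx orbT; case: eqP => [zx|_ /esym/eqP <- //].
    by rewrite zx ltnn in xz.
  by exists y; rewrite xy.
exists [set C | odd #|C :&: V|] => C D adj.
have [t [t' [tC tD t'C DE]]] := Ic_adj_swap adj.
have /and4P[minC minD _ _] := adj.
have tt'Q := swap_in_perfect minC minD perQ tC DE tD.
have ett' : e t t'.
  have [H _] := matchingP _ _ matQ; have /edgeP[a [b [eab /setP Eab]]] := H _ tt'Q.
  have tt' : t != t' by apply: contraNneq t'C => <-.
  have := Eab t; have := Eab t'; rewrite !inE !eqxx orbT /=.
  case/esym/orP => /eqP Et' /esym/orP[]/eqP Et; rewrite Et Et' ?eqxx // in tt' *.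
  by rewrite e_sym.
have Et : (t \in V) = (t < t')%N by apply: VE.
have Et' : (t' \in V) = (t' < t)%N by apply: VE; rewrite 1?e_sym 1?setUC.
have tt'V : (t' \in V) = ~~ (t \in V).
  rewrite Et Et' -leqNgt ltn_neqAle; case: eqP => // /val_inj E.
  by rewrite E tC in t'C.
rewrite [C \in _]in_set [D \in _]in_set (cardsD1 t (C :&: V)).
rewrite (cardsD1 t' (D :&: V)) !in_setI tC.
have -> : t' \in D by rewrite DE !inE eqxx orbT.
have -> : (C :&: V) :\ t = (D :&: V) :\ t'.
  apply/setP => x; rewrite DE !inE; case: (eqVneq x t') => [->|] /=.
    by rewrite (negPf t'C) !andbF.
  by case: (x == t); rewrite //= orbF.
by rewrite /= !oddD !oddb tt'V; case: (t \in V); case: (odd _).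
Qed.

Lemma perfect_sub_exchange (K : fieldType) d Q :
  kvanish (fun i => 'X_i ^+ 2 : {mpoly K[n]}) (edge_ideal e) d ->
  (n <= h + d)%N -> perfect_matching e Q -> Q \subset exchange_edges e.
Proof.
move=> van len perQ; have /andP[matQ _] := perQ.
apply/subsetP => E EQ; have [H _] := matchingP _ _ matQ.
have /edgeP[t [t' [ett' EE]]] := H E EQ; rewrite {H}EE in EQ *.
have et't : e t' t by rewrite e_sym.
pose p F := independent e (t |: F) && independent e (t' |: F).
have ind1 x : independent e (x |: set0).
  by apply/independentP => a b; rewrite !inE !orbF => /eqP-> /eqP->; rewrite e_irr.
have [F maxF] : {F | maxset p F} by apply: ex_maxset; exists set0; rewrite /p !ind1.
have /andP[indt indt'] := maxsetp maxF.
have tF : t \notin F.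
  apply/negP => tF; have /independentP/(_ t t') := indt'.
  by rewrite !inE eqxx tF orbT ett' => /(_ isT isT).
have t'F : t' \notin F.
  apply/negP => t'F; have /independentP/(_ t t') := indt.
  by rewrite !inE eqxx t'F orbT ett' => /(_ isT isT).
have cardF : (d <= #|F|.+1)%N.
  apply: (separating_face_card e_irr van tF t'F ett' indt indt') => [v vF|T].
    apply: contra vF => pvF; have := maxsetsup maxF _ (subsetUr [set v] F).
    by move/(_ pvF) => <-; rewrite setU11.
  (* A minimal cover avoiding [T] misses [t] or [t'], since it meets the matching edge once; its
     complement holds [T] and the missed vertex. *)
  rewrite independent_cover => /min_cover_sub[C minC CT].
  have indC : independent e (~: C) by rewrite independent_cover setCK min_cover_cover.
  have TC : T \subset ~: C by rewrite -setCS setCK.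
  have := min_cover_perfect_pair minC perQ EQ ett'.
  have indCx x : x \notin C -> independent e (x |: T).
    by move=> xC; apply: independentS indC; rewrite subUset TC sub1set inE xC.
  by have [_ /esym/indCx ->|/indCx ->] := boolP (t \in C); rewrite ?orbT.
(* By [cardF] and [len] this cover has at most [h] elements, hence is minimal. *)
have minF x : x \notin F -> independent e (x |: F) -> min_vertex_cover e (~: (x |: F)).
  move=> xF indx; apply: unmixed_cover_min; first by rewrite -independent_cover.
  rewrite -(leq_add2l #|x |: F|) cardsC card_ord cardsU1 xF.
  by apply: leq_trans len _; rewrite addnC leq_add2r.
(* The cover [~: (t |: F)] contains [t'] but not [t], so the exchange removes [t'] and adds [t]. *)
rewrite inE; apply/existsP; exists t'; apply/existsP; exists t.
rewrite et't setUC eqxx /=.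
apply/existsP; exists (~: (t |: F)); apply/existsP; exists (~: (t' |: F)).
have tt' := adj_neq e_irr ett'.
rewrite !minF //=; apply/andP; split.
  by apply/eqP => /setP/(_ t); rewrite !inE eqxx (negPf tt') (negPf tF).
apply/eqP/setP => x; rewrite !inE; case: (eqVneq x t) => [->|_].
  by rewrite (negPf tt') (negPf tF) orbT.
by rewrite negb_or orbF.
Qed.

End Unmixed.

(** The complement of a minimal cover is a maximal independent set: vanishing below the depth gives
    it at least [d] vertices, and the dimension at most [d]. *)
Lemma CM_graph_unmixed (K : fieldType) (n : nat) (e : rel 'I_n) :
  irreflexive e -> CM_graph K e -> exists d,
    kvanish (fun i => 'X_i ^+ 2 : {mpoly K[n]}) (edge_ideal e) d /\
    forall C, min_vertex_cover e C -> #|C| = (n - d)%N.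
Proof.
move=> e_irr [d [[[fs [regf <-]] _] dimd]].
have van : kvanish (fun i => 'X_i ^+ 2 : {mpoly K[n]}) (edge_ideal e) (size fs).
  apply: regular_seq_kvanish regf; first exact: edge_ideal_ideal.
  by exists 2%N.
exists (size fs); split=> // C minC.
have covC := min_cover_cover minC.
have leC : (#|C| <= n)%N by rewrite -[leqRHS]card_ord max_card.
have led : (size fs <= n - #|C|)%N.
  have -> : (n - #|C|)%N = #|~: C| by rewrite [RHS]cardsCs setCK card_ord.
  apply: (maximal_independent_card e_irr van).
    by rewrite independent_cover setCK.
  by move=> v; rewrite inE negbK; apply: min_cover_maximal_independent.
have -> : size fs = (n - #|C|)%N.
  by apply/eqP; rewrite eqn_leq led (cover_krull_dim covC dimd).
by rewrite subKn.
Qed.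

Theorem theorem5p10 (K : fieldType) (n : nat) (e : rel 'I_n) :
  simple_graph e -> no_isolated e -> CM_graph K e -> Konig e ->
  (exists P, perfect_matching e P /\
     (forall Q, perfect_matching e Q -> Q = P) /\
     P = exchange_edges e)
  /\ Ic_bipartite e.
Proof.
move=> [e_sym e_irr] noiso cmG konG.
have [d [van unmixed]] := CM_graph_unmixed e_irr cmG.
have [P perP le2n] := Konig_unmixed_perfect e_sym e_irr unmixed noiso konG.
(* Identifying every perfect matching with the exchange edges also yields uniqueness. *)
have PE Q : perfect_matching e Q -> Q = exchange_edges e.
  move=> perQ; apply/eqP; rewrite eqEsubset.
  rewrite (exchange_edges_sub_perfect e_sym e_irr unmixed le2n perQ) andbT.
  apply: (perfect_sub_exchange e_sym e_irr unmixed le2n van) => //.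
  by rewrite addnC -leq_subLR.
split; last exact: (Ic_bipartite_of_perfect e_sym e_irr unmixed le2n perP).
exists P; split=> //; split; last exact: PE.
by move=> Q perQ; rewrite (PE Q perQ) (PE P perP).
Qed.
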